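(* Let $\mathbf V$ be a congruence-modular variety of algebras, $A\in\mathbf V$, and $M\in\mathrm{Ab}[A,\mathbf V]$. The equivalence classes of extensions in $\mathbf V$ of $A$ by $M$, i.e., the elements of the set $\mathbf E_{\mathbf V}(A,M)$, correspond bijectively to the elements of the cohomology group (at the middle term) of the cochain complex fragment of abelian groups $$A\text{-}\mathbf{Set}(X^0,M)\xrightarrow{\ \partial\ }A\text{-}\mathbf{Set}(X^1,M)\xrightarrow{\ \partial\ }A\text{-}\mathbf{Set}(X^2,M),$$ the correspondence sending the class of an extension $\mathcal E$ to the cohomology class of the factor set $\mathrm f^{\mathcal E,\sigma}$ of $\mathcal E$ with respect to any section $\sigma$ of $\mathcal E$.
   Context: Algebras may be empty. $\mathrm{Clo}_n\mathbf V$ is the set of $n$-ary terms of $\mathbf V$ modulo the identities of $\mathbf V$; for $v'\in\mathrm{Clo}_{n'}\mathbf V$ and an $n'$-tuple $\mathbf v$ of elements of $\mathrm{Clo}_n\mathbf V$, $v'\mathbf v\in\mathrm{Clo}_n\mathbf V$ is the composite and $\mathbf v(\mathbf a)=\langle v_1(\mathbf a),\ldots,v_{n'}(\mathbf a)\rangle$. Functions are applied to tuples componentwise. Let $A\in\mathbf V$. An $A$-set $S$ is a family of sets $({}_aS)_{a\in A}$; an $A$-function $f:S\to S'$ is a family of functions ${}_af:{}_aS\to{}_aS'$; $A\text{-}\mathbf{Set}(S,S')$ is the set of these; for $\mathbf a\in A^n$ put ${}_{\mathbf a}S={}_{a_1}S\times\cdots\times{}_{a_n}S$. An $A$-overalgebra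 $Q$ is an $A$-set with, for each $n$-ary basic operation $\omega$ and $\mathbf a\in A^n$, a function $\omega^Q_{\mathbf a}:{}_{\mathbf a}Q\to{}_{\omega(\mathbf a)}Q$; homomorphisms are $A$-functions commuting with these. Its total algebra $A\ltimes Q$ is the set of pairs $\langle a,q\rangle$ ($q\in{}_aQ$) with $\omega(\langle a_1,q_1\rangle,\ldots)=\langle\omega(\mathbf a),\omega^Q_{\mathbf a}(\mathbf q)\rangle$; $Q$ is totally in $\mathbf V$ if $A\ltimes Q\in\mathbf V$, and then $v^Q_{\mathbf a}$ is defined for all $v\in\mathrm{Clo}_n\mathbf V$ by $v^{A\ltimes Q}(\langle a_1,q_1\rangle,\ldots)=\langle v(\mathbf a),v^Q_{\mathbf a}(\mathbf q)\rangle$. A pointed $A$-overalgebra has basepoints in each ${}_aP$ preserved by all operations; homomorphisms preserve basepoints. An abelian group $A$-overalgebra $M$ has abelian group structures on each ${}_aM$ such that all $\omega^M_{\mathbf a}$ are group homomorphisms; it is pointed by the zeros. $\mathrm{Ab}[A,\mathbf V]$ is the category of abelian group $A$-overalgebras totally in $\mathbf V$. For a homomorphism $f:X\to A$, ${}_f\mathrm{Res}\,M$ is the $X$-overalgebra with ${}_x({}_f\mathrm{Res}\,M)={}_{f(x)}M$, $\omega^{{}_f\mathrm{Res}M}_{\mathbf x}=\omega^M_{f(\mathbf x)}$. For a congruence $\kappa$ of $E$, $\kappa^*$ is the pointed $E$-overalgebra with ${}_e\kappa^*=\{e':e\mathrel\kappa e'\}$, basepoint $e$, $\omega^{\kappa^*}_{\mathbf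 e}(\mathbf c)=\omega(\mathbf c)$. An extension in $\mathbf V$ of $A$ by $M$ is $\mathcal E=\langle\chi,E,\pi\rangle$ with $E\in\mathbf V$, $\pi:E\to A$ an onto homomorphism, and $\chi:{}_\pi\mathrm{Res}\,M\to(\ker\pi)^*$ an isomorphism of pointed $E$-overalgebras; so ${}_e\chi:{}_{\pi(e)}M\to\pi^{-1}(\pi(e))$ is a bijection. An equivalence from $\mathcal E$ to $\tilde{\mathcal E}=\langle\tilde\chi,\tilde E,\tilde\pi\rangle$ is a homomorphism $\gamma:E\to\tilde E$ with $\pi=\tilde\pi\gamma$ and $\gamma({}_e\chi(m))={}_{\gamma(e)}\tilde\chi(m)$ for all $e\in E$, $m\in{}_{\pi(e)}M$. $\mathbf E_{\mathbf V}(A,M)$ is the set of equivalence classes. A section of $\mathcal E$ is a function $\sigma:A\to E$ (not necessarily a homomorphism) with $\pi\sigma=1_A$. $X^0,X^1,X^2$ are the $A$-sets with ${}_aX^0=\{[a]\}$; ${}_aX^1$ the set of $[v;\mathbf b]$ with $v\in\mathrm{Clo}_n\mathbf V$, $\mathbf b\in A^n$ for some $n$, and $v(\mathbf b)=a$; ${}_aX^2$ the set of $[v',\mathbf v;\mathbf b]$ with $\mathbf b\in A^n$, $\mathbf v\in(\mathrm{Clo}_n\mathbf V)^{n'}$, $v'\in\mathrm{Clo}_{n'}\mathbf V$ for some $n,n'$, and $v'(\mathbf v(\mathbf b))=a$. For $A$-functions with domain $X^i$ the left subscript is dropped. The factor set of $\mathcal E$ with respect to $\sigma$ is the $A$-function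 $\mathrm f^{\mathcal E,\sigma}:X^1\to M$, $\mathrm f^{\mathcal E,\sigma}[v;\mathbf a]={}_{\sigma(v(\mathbf a))}\chi^{-1}(v(\sigma(\mathbf a)))$. The sets $A\text{-}\mathbf{Set}(X^i,M)$ are abelian groups under pointwise addition, and $(\partial\delta)[v;\mathbf a]=v^M_{\mathbf a}(\delta[\mathbf a])-\delta[v(\mathbf a)]$ for $\delta:X^0\to M$, where $\delta[\mathbf a]=\langle\delta[a_1],\ldots,\delta[a_n]\rangle$; $(\partial\mathrm f)[v',\mathbf v;\mathbf a]=v'^M_{\mathbf v(\mathbf a)}\mathrm f[\mathbf v;\mathbf a]-\mathrm f[v'\mathbf v;\mathbf a]+\mathrm f[v';\mathbf v(\mathbf a)]$ for $\mathrm f:X^1\to M$, where $\mathrm f[\mathbf v;\mathbf a]=\langle\mathrm f[v_1;\mathbf a],\ldots,\mathrm f[v_{n'};\mathbf a]\rangle$. *)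

(* Defs.v *)
From HB Require Import structures.
From mathcomp Require Import all_boot all_algebra.
From mathcomp Require Import boolp.

Set Implicit Arguments.
Unset Strict Implicit.
Unset Printing Implicit Defensive.
#[local] Obligation Tactic := idtac.

Import GRing.Theory.
Local Open Scope ring_scope.
Local Open Scope quotient_scope.

(* n-tuples are functions with domain 'I_n, so that tuples of elements of
   dependent families are dependent functions.  Carriers may be empty. *)

Record signature := Signature { opsym :> Type; arity : opsym -> nat }.

Record algebra (Omega : signature) := Algebra {
  carrier :> Type;
  opr : forall w : Omega, ('I_(arity w) -> carrier) -> carrier }.

Record hom (Omega : signature) (B C : algebra Omega) := Hom {
  hom_fun :> B -> C;
  homP : forall (w : Omega) (b : 'I_(arity w) -> B),
    hom_fun (opr b) = opr (fun i => hom_fun (b i)) }.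

Section Terms.
Variable Omega : signature.

Inductive term (n : nat) : Type :=
| Var of 'I_n
| App (w : Omega) of ('I_(arity w) -> term n).

HB.instance Definition _ n := gen_eqMixin (term n).
HB.instance Definition _ n := gen_choiceMixin (term n).

Fixpoint eval (B : algebra Omega) n (t : term n) (b : 'I_n -> B) : B :=
  match t with
  | Var i => b i
  | App w ts => opr (fun j => eval (ts j) b)
  end.

Fixpoint subst m n (t : term m) (s : 'I_m -> term n) : term n :=
  match t with
  | Var i => s i
  | App w ts => App (fun j => subst (ts j) s)
  end.

Definition holds (B : algebra Omega) n (s t : term n) : Prop :=
  forall b : 'I_n -> B, eval s b = eval t b.

Definition variety (V : algebra Omega -> Prop) : Prop :=
  exists Sigma : forall n, term n -> term n -> Prop,
  forall B, V B <-> (forall n (s t : term n), Sigma n s t -> holds B s t).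

Lemma eval_subst (B : algebra Omega) m n (t : term m) (s : 'I_m -> term n)
    (b : 'I_n -> B) :
  eval (subst t s) b = eval t (fun i => eval (s i) b).
Proof. by elim: t => //= w ts IH; congr opr; apply/funext. Qed.

Lemma hom_eval (B C : algebra Omega) (f : hom B C) n (t : term n)
    (b : 'I_n -> B) :
  f (eval t b) = eval t (fun i => f (b i)).
Proof. by elim: t => //= w ts IH; rewrite homP; congr opr; apply/funext. Qed.

End Terms.

Section Congruences.
Variables (Omega : signature) (B : algebra Omega).

Record congruence := Congruence {
  cong_rel :> B -> B -> Prop;
  cong_refl : forall x, cong_rel x x;
  cong_sym : forall x y, cong_rel x y -> cong_rel y x;
  cong_trans : forall x y z, cong_rel x y -> cong_rel y z -> cong_rel x z;
  cong_opr : forall (w : Omega) (x y : 'I_(arity w) -> B),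
    (forall i, cong_rel (x i) (y i)) -> cong_rel (opr x) (opr y) }.

Definition cong_le (a b : congruence) : Prop := forall x y, a x y -> b x y.

Program Definition cong_meet (a b : congruence) : congruence :=
  @Congruence (fun x y => a x y /\ b x y) _ _ _ _.
Next Obligation. by move=> a b x; split; apply: cong_refl. Qed.
Next Obligation. by move=> a b x y [? ?]; split; apply: cong_sym. Qed.
Next Obligation.
by move=> a b x y z [? ?] [? ?]; split; apply: cong_trans; eassumption.
Qed.
Next Obligation.
by move=> a b w x y H; split; apply: cong_opr => i; case: (H i).
Qed.

Program Definition cong_join (a b : congruence) : congruence :=
  @Congruence (fun x y => forall c : congruence,
    cong_le a c -> cong_le b c -> c x y) _ _ _ _.
Next Obligation. by move=> a b x c _ _; apply: cong_refl. Qed.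
Next Obligation. by move=> a b x y H c ? ?; apply/cong_sym/H. Qed.
Next Obligation.
by move=> a b x y z H K c ? ?; apply: (@cong_trans c _ y); [apply: H|apply: K].
Qed.
Next Obligation. by move=> a b w x y H c ? ?; apply: cong_opr => i; apply: H. Qed.

(* The modular law; congruences are compared extensionally. *)
Definition modular_congruences : Prop :=
  forall a b c : congruence, cong_le a c -> forall x y,
    cong_join a (cong_meet b c) x y <-> cong_meet (cong_join a b) c x y.

End Congruences.

Definition congruence_modular (Omega : signature) (V : algebra Omega -> Prop) :=
  forall B, V B -> modular_congruences B.

Program Definition kernel (Omega : signature) (B C : algebra Omega)
  (f : hom B C) : congruence B := @Congruence _ _ (fun x y => f x = f y) _ _ _ _.
Next Obligation. by []. Qed.
Next Obligation. by move=> Omega B C f x y /= ->. Qed.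
Next Obligation. by move=> Omega B C f x y z /= -> ->. Qed.
Next Obligation.
by move=> Omega B C f w x y H /=; rewrite !homP; congr opr; apply/funext.
Qed.

Section Clones.
Variables (Omega : signature) (V : algebra Omega -> Prop).

Definition ident n (s t : term Omega n) : bool :=
  `[< forall B, V B -> holds B s t >].

Lemma ident_equiv n : equiv_class_of (@ident n).
Proof.
split=> [x|x y|y x z]; first exact/asboolP.
  by apply/asboolP/asboolP => H B VB b; rewrite H.
by move=> /asboolP H /asboolP K; apply/asboolP => B VB b; rewrite H // K.
Qed.

Canonical ident_equiv_rel n := EquivRelPack (@ident_equiv n).
Canonical ident_encModRel n := defaultEncModRel (@ident n).

Definition Clo n := {eq_quot (@ident n)}.
HB.instance Definition _ n : EqQuotient (term Omega n) (@ident n) (Clo n) :=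
  EqQuotient.on (Clo n).
HB.instance Definition _ n := Choice.on (Clo n).

(* Elements of the clone act through a representative; clo_piE shows that
   on algebras of V the choice is irrelevant. *)
Definition clo_eval n (v : Clo n) (B : algebra Omega) (b : 'I_n -> B) : B :=
  eval (repr v) b.

Definition clo_comp m n (v' : Clo m) (v : 'I_m -> Clo n) : Clo n :=
  \pi_(Clo n) (subst (repr v') (fun i => repr (v i))).

Lemma clo_piE n (t : term Omega n) (B : algebra Omega) (b : 'I_n -> B) :
  V B -> clo_eval (\pi_(Clo n) t) b = eval t b.
Proof.
move=> VB; have /eqmodP/asboolP : repr (\pi_(Clo n) t) = t %[mod Clo n].
  by rewrite reprK.
exact.
Qed.

Lemma clo_compE m n (v' : Clo m) (v : 'I_m -> Clo n) (B : algebra Omega)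
    (b : 'I_n -> B) :
  V B -> clo_eval (clo_comp v' v) b = clo_eval v' (fun i => clo_eval (v i) b).
Proof. by move=> VB; rewrite clo_piE // eval_subst. Qed.

Record valgebra := VAlgebra { valg :> algebra Omega; valgP : V valg }.

End Clones.

Section Overalgebras.
Variables (Omega : signature) (A : algebra Omega).

Record overalgebra := Overalgebra {
  fiber :> A -> Type;
  over_opr : forall (w : Omega) (a : 'I_(arity w) -> A),
    (forall i, fiber (a i)) -> fiber (opr a) }.

Definition total_algebra (Q : overalgebra) : algebra Omega :=
  @Algebra Omega {a : A & Q a} (fun w p =>
    Tagged Q (over_opr (fun i => tagged (p i)))).

Fixpoint over_eval (Q : overalgebra) n (t : term Omega n) (a : 'I_n -> A)
    (q : forall i, Q (a i)) : Q (eval t a) :=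
  match t return Q (eval t a) with
  | Var i => q i
  | App w ts => over_opr (fun j => over_eval (ts j) q)
  end.

Lemma eval_total_algebra (Q : overalgebra) n (t : term Omega n) (a : 'I_n -> A)
    (q : forall i, Q (a i)) :
  eval t (fun i => Tagged Q (q i) : total_algebra Q) = Tagged Q (over_eval t q).
Proof.
elim: t => [//|w ts IH].
exact: (congr1 (@opr _ (total_algebra Q) w) (funext IH)).
Qed.

Record pointed_overalgebra := PointedOveralgebra {
  pointed_over :> overalgebra;
  basepoint : forall a, pointed_over a;
  over_opr_basepoint : forall (w : Omega) (a : 'I_(arity w) -> A),
    over_opr (fun i => basepoint (a i)) = basepoint (opr a) }.

Record is_pointed_hom (P P' : pointed_overalgebra) (f : forall a, P a -> P' a) :
    Prop := IsPointedHom {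
  pointed_hom_opr : forall (w : Omega) (a : 'I_(arity w) -> A)
    (p : forall i, P (a i)), f _ (over_opr p) = over_opr (fun i => f _ (p i));
  pointed_hom_base : forall a, f a (basepoint P a) = basepoint P' a }.

Record pointed_iso (P P' : pointed_overalgebra) := PointedIso {
  iso_fun :> forall a, P a -> P' a;
  iso_inv : forall a, P' a -> P a;
  iso_fun_hom : is_pointed_hom iso_fun;
  iso_inv_hom : is_pointed_hom iso_inv;
  iso_funK : forall a, cancel (@iso_fun a) (@iso_inv a);
  iso_invK : forall a, cancel (@iso_inv a) (@iso_fun a) }.

(* The choice structure carried by zmodType is no restriction, since every type
   has one (gen_choiceMixin).  Preserving sums is all that is required of a
   group homomorphism out of the product, also for nullary operations. *)
Record ab_overalgebra := AbOveralgebra {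
  ab_fiber :> A -> zmodType;
  ab_opr : forall (w : Omega) (a : 'I_(arity w) -> A),
    (forall i, ab_fiber (a i)) -> ab_fiber (opr a);
  ab_oprD : forall (w : Omega) (a : 'I_(arity w) -> A)
    (x y : forall i, ab_fiber (a i)),
    ab_opr (fun i => x i + y i) = ab_opr x + ab_opr y }.

Definition over_of_ab (M : ab_overalgebra) : overalgebra :=
  @Overalgebra (fun a => M a) (@ab_opr M).

Lemma ab_opr0 (M : ab_overalgebra) (w : Omega) (a : 'I_(arity w) -> A) :
  ab_opr (fun i => 0 : M (a i)) = 0.
Proof.
apply: (addrI (ab_opr (fun i => 0 : M (a i)))).
by rewrite -ab_oprD addr0; congr ab_opr; apply: functional_extensionality_dep => i;
  rewrite addr0.
Qed.

Definition pointed_of_ab (M : ab_overalgebra) : pointed_overalgebra :=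
  @PointedOveralgebra (over_of_ab M) (fun a => 0 : M a) (@ab_opr0 M).

Definition clo_over (M : ab_overalgebra) (V : algebra Omega -> Prop) n
    (v : Clo V n) (a : 'I_n -> A) (m : forall i, M (a i)) : M (clo_eval v a) :=
  over_eval (Q := over_of_ab M) (repr v) m.

End Overalgebras.

Arguments Overalgebra {Omega A} fiber over_opr.
Arguments iso_fun {Omega A P P'} _ a _.
Arguments iso_inv {Omega A P P'} _ a _.

Coercion pointed_of_ab : ab_overalgebra >-> pointed_overalgebra.

Record Ab (Omega : signature) (V : algebra Omega -> Prop) (A : algebra Omega) :=
  AbIn { Ab_over :> ab_overalgebra A; totally_in : V (total_algebra Ab_over) }.

Section Restriction.
Variables (Omega : signature) (X A : algebra Omega) (f : hom X A).

Definition over_Res (Q : overalgebra A) : overalgebra X :=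
  Overalgebra (fun x => Q (f x)) (fun w x q =>
    ecast a (Q a) (esym (homP f x)) (over_opr q)).

Program Definition Res (P : pointed_overalgebra A) : pointed_overalgebra X :=
  @PointedOveralgebra Omega X (over_Res P) (fun x => basepoint P (f x)) _.
Next Obligation.
by move=> P w x /=; rewrite over_opr_basepoint; case: _ / (esym _).
Qed.

End Restriction.

Section Star.
Variables (Omega : signature) (E : algebra Omega) (k : congruence E).

Definition over_star : overalgebra E :=
  Overalgebra (fun e => {e' : E | k e e'}) (fun w e c =>
    exist (k (opr e)) (opr (fun i => sval (c i)))
      (cong_opr (fun i => proj2_sig (c i)))).

Program Definition star : pointed_overalgebra E :=
  @PointedOveralgebra Omega E over_star
    (fun e => exist (k e) e (cong_refl k e)) _.
Next Obligation. by move=> w e; congr exist; apply: Prop_irrelevance. Qed.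

End Star.

Section Extensions.
Variables (Omega : signature) (V : algebra Omega -> Prop) (A : valgebra V).
Variable M : Ab V A.

Record extension := Extension {
  ext_alg :> valgebra V;
  ext_pi : hom ext_alg A;
  ext_pi_onto : forall a, exists e, ext_pi e = a;
  ext_chi : pointed_iso (Res ext_pi M) (star (kernel ext_pi)) }.

Record equivalence (E E' : extension) := Equivalence {
  eqv_hom :> hom E E';
  eqv_pi : forall e, ext_pi E e = ext_pi E' (eqv_hom e);
  eqv_chi : forall e (m : M (ext_pi E e)),
    eqv_hom (sval (ext_chi E e m)) =
    sval (ext_chi E' (eqv_hom e) (ecast a (M a) (eqv_pi e) m)) }.

Definition equivalent (E E' : extension) : Prop := inhabited (equivalence E E').

Lemma ecast_comp (a1 a2 a3 : A) (p : a1 = a2) (q : a2 = a3) (r : a1 = a3)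
    (m : M a1) :
  ecast a (M a) q (ecast a (M a) p m) = ecast a (M a) r m.
Proof. by rewrite (Prop_irrelevance r (etrans p q)); case: _ / q; case: _ / p. Qed.

Lemma ecast_eq0 (a1 a2 : A) (p : a1 = a2) (m : M a1) :
  ecast a (M a) p m = 0 -> m = 0.
Proof. by case: _ / p. Qed.

Lemma chi_ecast (E : extension) (e e' : E) (m : M (ext_pi E e))
    (p : ext_pi E e = ext_pi E e') :
  e = e' -> sval (ext_chi E e m) = sval (ext_chi E e' (ecast a (M a) p m)).
Proof. by move=> ee'; case: _ / ee' p => p; rewrite (Prop_irrelevance p erefl). Qed.

Lemma equivalent_refl E : equivalent E E.
Proof.
split; apply: (@Equivalence E E (@Hom Omega E E id (fun _ _ => erefl))
  (fun=> erefl)) => //.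
Qed.

Lemma equivalent_trans E F G :
  equivalent E F -> equivalent F G -> equivalent E G.
Proof.
move=> [f] [g]; split.
have gfP (w : Omega) (b : 'I_(arity w) -> E) :
  g (f (opr b)) = opr (fun i => g (f (b i))) by rewrite !homP.
apply: (@Equivalence E G (Hom gfP)
  (fun e => etrans (eqv_pi f e) (eqv_pi g (f e)))) => e m /=.
by rewrite !eqv_chi (ecast_comp _ _ (etrans (eqv_pi f e) (eqv_pi g (f e)))).
Qed.

Lemma chi0 (E : extension) (e : E) : sval (ext_chi E e 0) = e.
Proof. by rewrite (pointed_hom_base (iso_fun_hom (ext_chi E))). Qed.

Lemma chi_surj (E : extension) (e e' : E) :
  ext_pi E e = ext_pi E e' -> exists m, e' = sval (ext_chi E e m).
Proof.
move=> ee'; exists (iso_inv (ext_chi E) e (exist (kernel (ext_pi E) e) e' ee')).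
by rewrite iso_invK.
Qed.

Lemma equivalence_bij (E F : extension) (f : equivalence E F) : bijective f.
Proof.
have finj : injective f.
  move=> e e' fee'; have [|m e'E] := @chi_surj E e e'.
    by rewrite !(eqv_pi f) fee'.
  have : ext_chi F (f e) 0 = ext_chi F (f e) (ecast a (M a) (eqv_pi f e) m).
    apply: eq_sig_hprop => [*|]; first exact: Prop_irrelevance.
    by rewrite chi0 -eqv_chi -e'E.
  move=> /(can_inj (@iso_funK _ _ _ _ (ext_chi F) (f e))) m0.
  rewrite e'E (_ : m = 0) ?chi0 //.
  exact: (ecast_eq0 (esym m0)).
have /choice[g gK] : forall y, exists x, f x = y.
  move=> y; have [e ey] := ext_pi_onto E (ext_pi F y).
  have [|m ->] := @chi_surj F (f e) y; first by rewrite -eqv_pi.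
  exists (sval (ext_chi E e (ecast a (M a) (esym (eqv_pi f e)) m))).
  by rewrite eqv_chi (ecast_comp _ _ erefl).
by exists g => // x; apply: finj.
Qed.

Lemma equivalent_sym E F : equivalent E F -> equivalent F E.
Proof.
move=> [f]; have [g fK gK] := equivalence_bij f; split.
have gP (w : Omega) (b : 'I_(arity w) -> F) :
  g (opr b) = opr (fun i => g (b i)).
  apply: (can_inj fK); rewrite gK homP; congr opr.
  by apply/funext => i; rewrite gK.
have gpi y : ext_pi F y = ext_pi E (g y) by rewrite (eqv_pi f) gK.
apply: (@Equivalence F E (Hom gP) gpi) => y m /=.
apply: (can_inj fK); rewrite gK eqv_chi.
rewrite (ecast_comp _ _ (congr1 (ext_pi F) (esym (gK y)))).
by apply: chi_ecast; rewrite gK.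
Qed.

(* Equivalence classes as sets of extensions.  The type set of classical_sets
   cannot be used here: its universe is too small for sets of extensions. *)
Definition ext_classes : Type :=
  {C : extension -> Prop | exists E, C = equivalent E}.

Definition ext_class (E : extension) : ext_classes :=
  exist _ (equivalent E) (ex_intro _ E erefl).

Record section (E : extension) := Section_ {
  sec_fun :> A -> E;
  sec_funK : cancel sec_fun (ext_pi E) }.

Lemma section_exists (E : extension) : inhabited (section E).
Proof. by have [s sK] := choice (@ext_pi_onto E); split; exists s. Qed.

Variant X0 (a : A) : Type := X0cell.

Variant X1 (a : A) : Type :=
  X1cell n (v : Clo V n) (b : 'I_n -> A) of clo_eval v b = a.

Variant X2 (a : A) : Type :=
  X2cell n' n (v' : Clo V n') (v : 'I_n' -> Clo V n) (b : 'I_n -> A)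
    of clo_eval v' (fun i => clo_eval (v i) b) = a.

Lemma factor_set_subproof (E : extension) (s : section E) n (v : Clo V n)
    (b : 'I_n -> A) (a : A) :
  clo_eval v b = a -> kernel (ext_pi E) (s a) (clo_eval v (fun i => s (b i))).
Proof.
move=> <- /=; rewrite sec_funK /clo_eval hom_eval; congr eval.
by apply/funext => i; rewrite sec_funK.
Qed.

Definition cochain (X : A -> Type) : Type := forall a, X a -> M a.

(* vb says v(b) = a, so s a is s(v(b)); the value of chi^-1 lies in the fibre of
   M at pi(s a) and is transported to the fibre at a. *)
Definition factor_set (E : extension) (s : section E) : cochain X1 :=
  fun a x => match x with
  | X1cell n v b vb =>
    ecast a (M a) (sec_funK s a)
      (iso_inv (ext_chi E) (s a)
         (exist (kernel (ext_pi E) (s a)) (clo_eval v (fun i => s (b i)))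
            (factor_set_subproof s vb)))
  end.

Section CochainZmodule.
Variable X : A -> Type.

HB.instance Definition _ := gen_eqMixin (cochain X).
HB.instance Definition _ := gen_choiceMixin (cochain X).

Definition cochain0 : cochain X := fun a x => 0.
Definition cochainN (f : cochain X) : cochain X := fun a x => - f a x.
Definition cochainD (f g : cochain X) : cochain X := fun a x => f a x + g a x.

Lemma cochainP (f g : cochain X) : (forall a x, f a x = g a x) -> f = g.
Proof.
by move=> H; apply: functional_extensionality_dep => a; apply/funext => x.
Qed.

Lemma cochainDA : associative cochainD.
Proof. by move=> f g h; apply: cochainP => a x; apply: addrA. Qed.
Lemma cochainDC : commutative cochainD.
Proof. by move=> f g; apply: cochainP => a x; apply: addrC. Qed.
Lemma cochain0D : left_id cochain0 cochainD.
Proof. by move=> f; apply: cochainP => a x; apply: add0r. Qed.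
Lemma cochainND : left_inverse cochain0 cochainN cochainD.
Proof. by move=> f; apply: cochainP => a x; apply: addNr. Qed.

HB.instance Definition _ := GRing.isZmodule.Build (cochain X)
  cochainDA cochainDC cochain0D cochainND.

End CochainZmodule.

Definition bd0 (d : cochain X0) : cochain X1 :=
  fun a x => match x with
  | X1cell n v b vb =>
    ecast a (M a) vb
      (clo_over v (fun i => d _ (X0cell (b i))) -
       d _ (X0cell (clo_eval v b)))
  end.

(* The middle cell [v'v; b] is seen in the fibre of X1 over v'(v(b)) by
   clo_compE. *)
Definition bd1 (f : cochain X1) : cochain X2 :=
  fun a x => match x with
  | X2cell n' n v' v b e =>
    let vb := fun i => clo_eval (v i) b in
    ecast a (M a) e
      (clo_over v' (fun i => f _ (X1cell (erefl (vb i)))) -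
       f _ (X1cell (clo_compE v' v b (valgP A))) +
       f _ (X1cell (erefl (clo_eval v' vb))))
  end.

Lemma over_evalB n (t : term Omega n) (a : 'I_n -> A)
    (x y : forall i, M (a i)) :
  over_eval (Q := over_of_ab M) t (fun i => x i - y i) =
  (over_eval (Q := over_of_ab M) t x : M _) -
  (over_eval (Q := over_of_ab M) t y : M _).
Proof.
elim: t => //= w ts IH.
apply/eqP; rewrite eq_sym subr_eq -ab_oprD; apply/eqP.
congr ab_opr; apply: functional_extensionality_dep => i.
by rewrite IH subrK.
Qed.

Let subACA (U : zmodType) (x y p q : U) : (x - y) - (p - q) = (x - p) - (y - q).
Proof. by rewrite !opprD !opprK addrACA. Qed.

Let subACA2 (U : zmodType) (x y p q : U) : (x - y) + (p - q) = (x + p) - (y + q).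
Proof. by rewrite opprD addrACA. Qed.

Lemma cochainB (X : A -> Type) (f g : cochain X) a (x : X a) :
  (f - g) a x = f a x - g a x.
Proof. by []. Qed.

Lemma bd0_is_zmod_morphism : zmod_morphism bd0.
Proof.
move=> d d'; apply: cochainP => a [n v b vb]; rewrite cochainB /=.
by case: _ / vb; rewrite /clo_over over_evalB !cochainB subACA.
Qed.

HB.instance Definition _ :=
  GRing.isZmodMorphism.Build (cochain X0) (cochain X1) bd0 bd0_is_zmod_morphism.

Lemma bd1_is_zmod_morphism : zmod_morphism bd1.
Proof.
move=> f g; apply: cochainP => a [n' n v' v b e]; rewrite cochainB /=.
case: _ / e; rewrite /clo_over over_evalB !cochainB /=.
by rewrite subACA subACA2.
Qed.

HB.instance Definition _ :=
  GRing.isZmodMorphism.Build (cochain X1) (cochain X2) bd1 bd1_is_zmod_morphism.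

Lemma ecast_Tagged (a a' : A) (m : M a) (m' : M a') (e : a = a') :
  Tagged (fun a => M a : Type) m = Tagged (fun a => M a : Type) m' ->
  ecast a (M a) e m = m'.
Proof.
by move=> H; rewrite (Prop_irrelevance e (projT1_eq H)); apply: (projT2_eq H).
Qed.

Lemma clo_over_comp m n (v' : Clo V m) (v : 'I_m -> Clo V n) (b : 'I_n -> A)
    (x : forall i, M (b i)) :
  ecast a (M a) (clo_compE v' v b (valgP A)) (clo_over (clo_comp v' v) x) =
  clo_over v' (fun i => clo_over (v i) x).
Proof.
apply: ecast_Tagged.
have := clo_compE v' v
  (fun i => Tagged (fun a => M a : Type) (x i) : total_algebra (over_of_ab M))
  (totally_in M).
rewrite /clo_eval !(eval_total_algebra (Q := over_of_ab M)) => ->.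
rewrite (_ : (fun i => _) = (fun i => Tagged (fun a => M a : Type) (clo_over (v i) x) :
  total_algebra (over_of_ab M))); last first.
  by apply/funext => i; exact: (eval_total_algebra (Q := over_of_ab M)).
exact: (eval_total_algebra (Q := over_of_ab M)).
Qed.

Lemma bd1_bd0 (d : cochain X0) : bd1 (bd0 d) = 0.
Proof.
apply: cochainP => a [n' n v' v b e] /=; case: _ / e.
rewrite {1}/clo_over over_evalB.
have ecastB (a1 a2 : A) (e : a1 = a2) (m : M a1) :
    ecast a (M a) e (m - d _ (X0cell a1)) =
    ecast a (M a) e m - d _ (X0cell a2) by case: _ / e.
by rewrite ecastB clo_over_comp subACA subrr sub0r addNr.
Qed.

Record cocycle := Cocycle {
  cocycle_val :> cochain X1;
  cocycle_valP : cocycle_val \in [pred f | bd1 f == 0] }.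

Fact cocycle_zmod_closed : zmod_closed [pred f : cochain X1 | bd1 f == 0].
Proof.
split=> [|f g]; rewrite !inE ?raddf0 // => /eqP bf /eqP bg.
by rewrite bd1_is_zmod_morphism bf bg subr0.
Qed.

HB.instance Definition _ := GRing.isZmodClosed.Build (cochain X1)
  [pred f | bd1 f == 0] cocycle_zmod_closed.
HB.instance Definition _ := [isSub for cocycle_val].
HB.instance Definition _ := [Choice of cocycle by <:].
HB.instance Definition _ := [SubChoice_isSubZmodule of cocycle by <:].

Definition coboundary : {pred cocycle} :=
  fun z => `[< exists d : cochain X0, cocycle_val z = bd0 d >].

Fact coboundary_zmod_closed : zmod_closed coboundary.
Proof.
split=> [|z z' /asboolP[d zd] /asboolP[d' zd']]; apply/asboolP.
  by exists 0; rewrite raddf0.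
by exists (d - d'); rewrite bd0_is_zmod_morphism -zd -zd'.
Qed.

HB.instance Definition _ := GRing.isZmodClosed.Build cocycle coboundary
  coboundary_zmod_closed.

Definition cohomology : zmodType := Quotient.quot coboundary.

Definition cohomology_class (z : cocycle) : cohomology :=
  \pi_(Quotient.quot coboundary) z.

End Extensions.

(* Main.v *)
From mathcomp Require Import all_boot all_order all_algebra.
From mathcomp Require Import boolp.
Require Import Defs.

(** The key fact is that chi is a torsor structure: chi_e(m) is to be thought
    of as e + m, and the law (e + m) + m' = e + (m + m') holds although the
    definition of an extension only asks chi to respect basepoints and
    operations.  This is the one place where congruence modularity enters
    ([diff_trans]).  In place of a difference term, the proof applies the
    Shifting Lemma ([shifting]) to the algebra of triples (e0, e1, e2) lying in
    one fibre of pi, which is in V as a subalgebra of E^3.  Writing e' - e for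
    the m with e' = chi_e(m), the map
      (e0, e1, e2) |-> (e1 - e0) + (e2 - e1) - (e2 - e0)
    is a homomorphism to the total algebra of M, hence its kernel is a
    congruence.  It vanishes whenever e0 = e1; in particular it
    agrees on (e1, e1, e2) and (e1, e1, e1).  Changing the first entry of both
    to e0, the Shifting Lemma gives that it takes the same value on (e0, e1, e2)
    as on (e0, e1, e1), and there it is zero.

    Given this, the classical computations with factor sets go through.  Since
    chi commutes with all terms ([diff_eval]), f[v; b] is the difference
    v(s(b)) - s(v(b)).  Expanding v'(v(s(b))) in two ways yields the cocycle
    identity ([factor_set_cocycle]); adding d to a section adds the coboundary
    of d to its factor set ([factor_set_shift]), and any two sections differ by
    some d, so the cohomology class depends on the extension only; equivalences
    carry sections to sections with the same factor set.  Conversely, if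
    sections s of E and t of F have the same factor set, then
    s(a) + m |-> t(a) + m is an equivalence ([equivalent_of_factor_set]).
    Finally every cocycle f is a factor set: twist the operations of the total
    algebra of M by f.  The cocycle identity says exactly that a term t then
    evaluates to the value of t in the total algebra plus f[t; b]
    ([eval_twisted]); as f[t; b] depends only on the class of t in the clone,
    the twisted algebra satisfies the identities of V. *)

Set Implicit Arguments.
Unset Strict Implicit.
Unset Printing Implicit Defensive.
Import GRing.Theory.
Local Open Scope ring_scope.
Local Open Scope quotient_scope.

(** * Congruences, varieties and clones *)

Lemma dependent_choice (I : Type) (T : I -> Type) (P : forall i, T i -> Prop) :
  (forall i, exists x, P i x) -> exists f : (forall i, T i), forall i, P i (f i).
Proof. by move=> H; exists (fun i => projT1 (cid (H i))) => i; case: cid. Qed.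

(** Gumm's Shifting Lemma.  The pair (x, y) lies in the meet of alpha with the
    join of beta and alpha /\ gamma, via z and u; by modularity this is the
    join of alpha /\ gamma with alpha /\ beta, which is below gamma. *)
Lemma shifting (Omega : signature) (B : algebra Omega)
    (alpha beta gamma : congruence B) :
  modular_congruences B -> cong_le (cong_meet alpha beta) gamma ->
  forall x y z u, alpha x y -> beta x z -> beta y u -> alpha z u ->
    gamma z u -> gamma x y.
Proof.
move=> modB abg x y z u axy bxz byu azu gzu.
have agc : cong_le (cong_meet alpha gamma) alpha by move=> ? ? [].
have [_ /(_ _)] := modB (cong_meet alpha gamma) beta alpha agc x y.
apply; last 2 first.
- by move=> ? ? [].
- by move=> p q [bpq apq]; apply: abg.
split=> // c agc' bc.
apply: (@cong_trans _ _ c _ z); first exact: bc.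
apply: (@cong_trans _ _ c _ u); first exact: agc'.
by apply: bc; apply: cong_sym.
Qed.

(** B embeds in the product of the C i, and varieties are closed under
    subalgebras and products.  Identities can be checked in each C i directly,
    so the product itself need not be formed. *)
Lemma variety_separated (Omega : signature) (V : algebra Omega -> Prop)
    (B : algebra Omega) (I : Type) (C : I -> algebra Omega)
    (f : forall i, hom B (C i)) :
  variety V -> (forall i, V (C i)) ->
  (forall x y : B, (forall i, f i x = f i y) -> x = y) -> V B.
Proof.
move=> [Sigma SigmaP] VC finj; apply/SigmaP => n s t st b.
apply: finj => i; rewrite !hom_eval.
by have /SigmaP/(_ _ _ _ st) := VC i; apply.
Qed.

Lemma clo_ext (Omega : signature) (V : algebra Omega -> Prop) n (u v : Clo V n) :
  (forall B, V B -> forall b : 'I_n -> B, clo_eval u b = clo_eval v b) -> u = v.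
Proof.
move=> H; rewrite -[u]reprK -[v]reprK; apply/eqmodP/asboolP => B VB b.
exact: H.
Qed.

Lemma clo_eval_opr (Omega : signature) (V : algebra Omega -> Prop)
    (B : algebra Omega) (w : Omega) (b : 'I_(arity w) -> B) :
  V B -> clo_eval (\pi_(Clo V (arity w)) (App (fun i => Var Omega i))) b = opr b.
Proof. by move=> VB; rewrite clo_piE. Qed.

(** * The difference relation of an extension *)

Section Extensions.
Variables (Omega : signature) (V : algebra Omega -> Prop) (A : valgebra V).
Variable M : Ab V A.

Section Difference.
Variable E : extension M.

(** [diff e x e'] says that e' = e + x.  A relation, with the fibre a of x free,
    is used in place of chi and its inverse so that differences compose without
    transport along equations between points of A. *)
Definition diff (e : E) (a : A) (x : M a) (e' : E) : Prop :=
  exists p : ext_pi E e = a, sval (ext_chi E e (ecast a (M a) (esym p) x)) = e'.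

Lemma diff_chi e (m : M (ext_pi E e)) : diff e m (sval (ext_chi E e m)).
Proof. by exists erefl. Qed.

Lemma diff_pi e a (x : M a) e' : diff e x e' -> ext_pi E e = a.
Proof. by case. Qed.

Lemma diff_pir e a (x : M a) e' : diff e x e' -> ext_pi E e' = a.
Proof.
by case=> p <-; case: (ext_chi E e _) => /= e1 <-.
Qed.

Lemma diff_funr e a (x : M a) e1 e2 : diff e x e1 -> diff e x e2 -> e1 = e2.
Proof. by move=> [p <-] [q <-]; rewrite (Prop_irrelevance p q). Qed.

Lemma diff_inj e a (x y : M a) e' : diff e x e' -> diff e y e' -> x = y.
Proof.
move=> [p]; case: _ / p x y => /= x y xe [q].
rewrite (Prop_irrelevance q erefl) /= -xe => yx.
apply: (can_inj (@iso_funK _ _ _ _ (ext_chi E) e)).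
by apply: eq_sig_hprop => [*|]; first exact: Prop_irrelevance.
Qed.

Lemma diff0 e a : ext_pi E e = a -> diff e (0 : M a) e.
Proof. by case: _ /; exists erefl => /=; rewrite chi0. Qed.

Lemma diff_exr e a (x : M a) : ext_pi E e = a -> exists e', diff e x e'.
Proof. by move=> p; eexists; exists p. Qed.

Lemma diff_ex e e' a :
  ext_pi E e = a -> ext_pi E e' = a -> exists x : M a, diff e x e'.
Proof.
move=> p q; case: _ / p q => q; have [m ->] := @chi_surj _ _ _ _ E e e' (esym q).
by exists m; apply: diff_chi.
Qed.

Lemma diff_opr (w : Omega) (e e' : 'I_(arity w) -> E) (a : 'I_(arity w) -> A)
    (x : forall i, M (a i)) :
  (forall i, diff (e i) (x i) (e' i)) -> diff (opr e) (ab_opr x) (opr e').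
Proof.
move=> H; have pa : (fun i => ext_pi E (e i)) = a.
  by apply/funext => i; apply: diff_pi (H i).
case: _ / pa x H => x H; exists (homP (ext_pi E) e).
have -> : e' = fun i => sval (ext_chi E (e i) (x i)).
  by apply/funext => i; case: (H i) => p <-; rewrite (Prop_irrelevance p erefl).
exact: (congr1 sval (pointed_hom_opr (iso_fun_hom (ext_chi E)) x)).
Qed.

Lemma diff_eval n (t : term Omega n) (e e' : 'I_n -> E) (a : 'I_n -> A)
    (x : forall i, M (a i)) :
  (forall i, diff (e i) (x i) (e' i)) ->
  diff (eval t e) (over_eval (Q := over_of_ab M) t x : M _) (eval t e').
Proof. by move=> H; elim: t => [i|w ts IH] /=; [apply: H|apply: diff_opr]. Qed.

Section Transitivity.
Hypotheses (hV : variety V) (hmod : congruence_modular V).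

Let triple : Type :=
  {t : 'I_3 -> E | forall i j, ext_pi E (t i) = ext_pi E (t j)}.

Let triple_opr_subproof (w : Omega) (t : 'I_(arity w) -> triple) i j :
  ext_pi E (opr (fun k => sval (t k) i)) = ext_pi E (opr (fun k => sval (t k) j)).
Proof.
by rewrite !homP; congr opr; apply/funext => k; apply: (svalP (t k)).
Qed.

Let triples : algebra Omega :=
  @Algebra Omega triple (fun w t =>
    exist _ (fun i => opr (fun k => sval (t k) i)) (triple_opr_subproof t)).

Let proj (i : 'I_3) : hom triples E :=
  @Hom Omega triples E (fun t => sval t i) (fun w t => erefl).

Let triple_ext (t u : triples) : (forall i, proj i t = proj i u) -> t = u.
Proof.
move=> H; apply: eq_sig_hprop => [*|]; first exact: Prop_irrelevance.
exact/funext.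
Qed.

Let triplesP : V triples.
Proof. exact: (variety_separated hV (fun i : 'I_3 => valgP E) triple_ext). Qed.

Let i0 : 'I_3 := inord 0.
Let i1 : 'I_3 := inord 1.
Let i2 : 'I_3 := inord 2.

Let ord3 (i : 'I_3) : i \in [:: i0; i1; i2].
Proof.
by rewrite !inE -!(inj_eq val_inj) /= !inordK //; case: i => [[|[|[]]]].
Qed.

(** The failure r of the law (e1 - e0) + (e2 - e1) = e2 - e0 at the triple t. *)
Let defect (t : triples) a (r : M a) : Prop :=
  exists x y z : M a, [/\ diff (proj i0 t) x (proj i1 t),
    diff (proj i1 t) y (proj i2 t), diff (proj i0 t) z (proj i2 t) &
    r = x + y - z].

Let defect_ex t a : ext_pi E (proj i0 t) = a -> exists r : M a, defect t r.
Proof.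
move=> t0; have ta i : ext_pi E (proj i t) = a by rewrite -t0; apply: (svalP t).
have [x dx] := diff_ex (ta i0) (ta i1).
have [y dy] := diff_ex (ta i1) (ta i2).
have [z dz] := diff_ex (ta i0) (ta i2).
by exists (x + y - z), x, y, z.
Qed.

Let defect_pi t a (r : M a) : defect t r -> ext_pi E (proj i0 t) = a.
Proof. by case=> [x [y [z [/diff_pi]]]]. Qed.

Let defect_inj t a (r r' : M a) : defect t r -> defect t r' -> r = r'.
Proof.
move=> [x [y [z [dx dy dz ->]]]] [x' [y' [z' [dx' dy' dz' ->]]]].
by rewrite (diff_inj dx dx') (diff_inj dy dy') (diff_inj dz dz').
Qed.

Let defect_opr (w : Omega) (t : 'I_(arity w) -> triples) (a : 'I_(arity w) -> A)
    (r : forall i, M (a i)) :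
  (forall i, defect (t i) (r i)) -> defect (opr t) (ab_opr r).
Proof.
move=> /dependent_choice[x] /dependent_choice[y] /dependent_choice[z H].
exists (ab_opr x), (ab_opr y), (ab_opr z); rewrite !homP; split.
- by apply: diff_opr => i; case: (H i).
- by apply: diff_opr => i; case: (H i).
- by apply: diff_opr => i; case: (H i).
apply/eqP; rewrite eq_sym subr_eq -!ab_oprD; apply/eqP; congr ab_opr.
by apply: functional_extensionality_dep => i; case: (H i) => _ _ _ ->; rewrite subrK.
Qed.

Let defect_common t u a (r : M a) : defect t r -> defect u r ->
  forall b (r' : M b), defect t r' -> defect u r'.
Proof.
move=> dt du b r' dr'; have ab : a = b by rewrite -(defect_pi dt) (defect_pi dr').
by case: _ / ab r' dr' => r' dr'; rewrite (defect_inj dr' dt).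
Qed.

Let same_defect_opr (w : Omega) (t u : 'I_(arity w) -> triples) :
  (forall i a (r : M a), defect (t i) r <-> defect (u i) r) ->
  forall a (r : M a), defect (opr t) r <-> defect (opr u) r.
Proof.
move=> H a r.
have [s sP] := dependent_choice (fun i => @defect_ex (t i) _ erefl).
have dt := defect_opr sP.
have du : defect (opr u) (ab_opr s) by apply: defect_opr => i; apply/H.
by split; [apply: defect_common dt du _ _|apply: defect_common du dt _ _].
Qed.

(** The kernel of the defect.  It is encoded through the relation because the
    values of the defect at two triples may lie in different fibres of M. *)
Let same_defect : congruence triples.
Proof.
apply: (@Congruence _ triples
  (fun t u => forall a (r : M a), defect t r <-> defect u r)).
- by [].
- by move=> t u H a r; split=> /H.
- by move=> t u v H K a r; split=> [/H/K|/K/H].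
- exact: same_defect_opr.
Defined.

Let triple_of (e0 e1 e2 : E) (p : ext_pi E e0 = ext_pi E e1)
    (q : ext_pi E e1 = ext_pi E e2) : triples.
Proof.
exists (fun i : 'I_3 => nth e0 [:: e0; e1; e2] i).
suff H (i : 'I_3) : ext_pi E (nth e0 [:: e0; e1; e2] i) = ext_pi E e0.
  by move=> i j; rewrite !H.
by case: i => [[|[|[]]]] //= _; rewrite p.
Defined.

Let triple_ofE e0 e1 e2 (p : ext_pi E e0 = ext_pi E e1)
    (q : ext_pi E e1 = ext_pi E e2) :
  (proj i0 (triple_of p q) = e0) * (proj i1 (triple_of p q) = e1) *
  (proj i2 (triple_of p q) = e2).
Proof. by rewrite /= !inordK. Qed.

Let defect_degenerate t a :
  proj i0 t = proj i1 t -> ext_pi E (proj i0 t) = a -> defect t (0 : M a).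
Proof.
move=> t01 t0; have t2 : ext_pi E (proj i2 t) = a by rewrite -t0; apply: (svalP t).
have [u du] := diff_ex t0 t2.
by exists 0, u, u; split; rewrite -?t01 ?add0r ?subrr //; apply: diff0.
Qed.

(** Associativity (e + x) + y = e + (x + y) of the action of M on E. *)
Lemma diff_trans e a (x y : M a) e' e'' :
  diff e x e' -> diff e' y e'' -> diff e (x + y) e''.
Proof.
move=> dx dy; have [z dz] := diff_ex (diff_pi dx) (diff_pir dy).
have pe' := diff_pir dx.
have p := etrans (diff_pi dx) (esym pe'); have q := etrans pe' (esym (diff_pir dy)).
(* The parallelogram for the Shifting Lemma: alpha relates triples with the same
   first two entries, beta those with the same last two.  Both together leave
   only equality. *)
pose X := triple_of p q; pose Y := triple_of p erefl.
pose Z := triple_of (erefl (ext_pi E e')) q.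
pose U := triple_of (erefl (ext_pi E e')) erefl.
have sep : cong_le (cong_meet (cong_meet (kernel (proj i0)) (kernel (proj i1)))
    (cong_meet (kernel (proj i1)) (kernel (proj i2)))) same_defect.
  move=> t u [[h0 h1] [_ h2]]; suff -> : t = u by [].
  by apply: triple_ext => i; have := ord3 i; rewrite !inE => /or3P[] /eqP ->.
have /(_ _ (x + y - z))[XY _] : same_defect X Y.
  apply: (shifting (hmod triplesP) sep (z := Z) (u := U)).
  - by split; rewrite /= !inordK.
  - by split; rewrite /= !inordK.
  - by split; rewrite /= !inordK.
  - by split; rewrite /= !inordK.
  have dZ : defect Z (0 : M a) by apply: defect_degenerate; rewrite !triple_ofE.
  have dU : defect U (0 : M a) by apply: defect_degenerate; rewrite !triple_ofE.
  by move=> b r; split; [apply: defect_common dZ dU _ _|apply: defect_common dU dZ _ _].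
have /XY[x' [y' [z']]] : defect X (x + y - z) by exists x, y, z; rewrite !triple_ofE.
rewrite !triple_ofE => -[dx' dy' dz' xyz].
suff -> : x + y = z by [].
(* At Y the last two entries agree, so the differences are x', 0 and x'. *)
apply/eqP; rewrite -subr_eq0 xyz (diff_inj dx' dz') (diff_inj dy' (diff0 pe')).
by rewrite addr0 subrr.
Qed.

End Transitivity.
End Difference.

(** * Factor sets *)

(** The proof of v(b) = a carried by a cell is irrelevant, so cells may be
    rewritten along equations in the clone. *)
Lemma X1cell_clo (f : cochain M (@X1 _ V A)) n (u v : Clo V n) (b : 'I_n -> A) a
    (p : clo_eval u b = a) (q : clo_eval v b = a) :
  u = v -> f a (X1cell p) = f a (X1cell q).
Proof. by move=> uv; case: _ / uv q => q; rewrite (Prop_irrelevance p q). Qed.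

Lemma diff_factor_set (E : extension M) (s : section E) n (v : Clo V n)
    (b : 'I_n -> A) a (p : clo_eval v b = a) :
  diff (s a) (factor_set s (X1cell p)) (clo_eval v (fun i => s (b i))).
Proof.
exists (sec_funK s a); rewrite /factor_set (ecast_comp _ _ erefl) /=.
by rewrite iso_invK.
Qed.

(** Differences are unique, so the equations v(s(b)) = s(v(b)) + f[v; b]
    determine f; cells over v(b) itself suffice. *)
Lemma factor_setP (E : extension M) (s : section E) (f : cochain M (@X1 _ V A)) :
  (forall n (v : Clo V n) (b : 'I_n -> A),
    diff (s (clo_eval v b)) (f _ (X1cell (erefl (clo_eval v b))))
      (clo_eval v (fun i => s (b i)))) ->
  f = factor_set s.
Proof.
move=> H; apply: cochainP => a [n v b p]; case: _ / p.
by apply: diff_inj (H _ v b) _; apply: diff_factor_set.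
Qed.

Lemma diff_clo (E : extension M) n (v : Clo V n) (e e' : 'I_n -> E)
    (a : 'I_n -> A) (x : forall i, M (a i)) :
  (forall i, diff (e i) (x i) (e' i)) ->
  diff (clo_eval v e) (clo_over v x) (clo_eval v e').
Proof. exact: diff_eval. Qed.

Lemma equivalence_diff (E F : extension M) (f : equivalence E F) e a (x : M a) e' :
  diff e x e' -> diff (f e) x (f e').
Proof.
move=> [p]; case: _ / p x => x <- /=; exists (esym (eqv_pi f e)).
by rewrite eqv_chi esymK.
Qed.

(** The transport along [eqv_pi] in the definition of an equivalence is absorbed
    by [diff], whose fibre index is free. *)
Lemma equivalent_of_diff (E F : extension M) (g : hom E F) :
  (forall e, ext_pi E e = ext_pi F (g e)) ->
  (forall e a (x : M a) e', diff e x e' -> diff (g e) x (g e')) ->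
  equivalent E F.
Proof.
move=> gpi gdiff; split; apply: (@Equivalence _ _ _ _ _ _ g gpi) => e m.
have [p <-] := gdiff _ _ _ _ (diff_chi m).
by rewrite (Prop_irrelevance (esym p) (gpi e)).
Qed.

Lemma ext_classP (E F : extension M) :
  ext_class E = ext_class F <-> equivalent E F.
Proof.
split=> [[EF]|EF]; first by rewrite EF; apply: equivalent_refl.
apply: eq_sig_hprop => [*|/=]; first exact: Prop_irrelevance.
apply/funext => G; apply/propext; split; apply: equivalent_trans => //.
exact: equivalent_sym.
Qed.

Lemma ext_class_surj (C : ext_classes M) : exists E, C = ext_class E.
Proof.
case: C => C CE; have [E EC] := CE; exists E.
by apply: eq_sig_hprop => [*|//]; exact: Prop_irrelevance.
Qed.

Lemma factor_set_equivalence (E F : extension M) (f : equivalence E F) (s : section E) :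
  exists t : section F, factor_set t = factor_set s.
Proof.
have fsK : cancel (fun a => f (s a)) (ext_pi F).
  by move=> a; rewrite -eqv_pi sec_funK.
exists (Section_ fsK); apply/esym/factor_setP => n v b /=.
have := equivalence_diff f (diff_factor_set s (erefl (clo_eval v b))).
by rewrite {4}/clo_eval hom_eval.
Qed.

Section Modular.
Hypotheses (hV : variety V) (hmod : congruence_modular V).

(** By associativity, v'(v(s(b))) = v'(s(v(b)) + f[v; b]) is both
    s(v'(v(b))) + f[v'; v(b)] + v'(f[v; b]) and s(v'(v(b))) + f[v'v; b]. *)
Lemma factor_set_cocycle (E : extension M) (s : section E) :
  bd1 (factor_set s) = 0.
Proof.
apply: cochainP => a [n' n v' v b e]; rewrite /bd1; case: _ / e => /=.
rewrite addrAC; apply/eqP; rewrite subr_eq add0r; apply/eqP; rewrite addrC.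
have d1 := diff_factor_set s (erefl (clo_eval v' (fun i => clo_eval (v i) b))).
have d2 := diff_clo v' (fun i => diff_factor_set s (erefl (clo_eval (v i) b))).
apply: diff_inj (diff_trans hV hmod d1 d2) _.
have := diff_factor_set s (clo_compE v' v b (valgP A)).
by rewrite [X in diff _ _ X]clo_compE //; exact: valgP.
Qed.

(** Both sides of f_s[v; b] + v(d[b]) = d[v(b)] + f_t[v; b] are the difference
    from s(v(b)) to v(t(b)), taken through v(s(b)) and through t(v(b)). *)
Lemma factor_set_shift (E : extension M) (s t : section E) (d : cochain M (@X0 _ V A)) :
  (forall a, diff (s a) (d a (X0cell a)) (t a)) ->
  factor_set t = factor_set s + bd0 d.
Proof.
move=> st; apply: cochainP => a [n v b p]; case: _ / p.
have d1 := diff_factor_set s (erefl (clo_eval v b)).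
have d2 := diff_clo v (fun i => st (b i)).
have d3 := diff_factor_set t (erefl (clo_eval v b)).
have := diff_inj (diff_trans hV hmod d1 d2) (diff_trans hV hmod (st _) d3).
move=> H; change (factor_set t (X1cell (erefl (clo_eval v b))) =
  factor_set s (X1cell (erefl (clo_eval v b))) +
  (clo_over v (fun i => d _ (X0cell (b i))) - d _ (X0cell (clo_eval v b)))).
by rewrite addrA H addrC addKr.
Qed.

Lemma sections_shift (E : extension M) (s t : section E) :
  exists d : cochain M (@X0 _ V A), forall a, diff (s a) (d a (X0cell a)) (t a).
Proof.
have [d dP] := dependent_choice (fun a => diff_ex (sec_funK s a) (sec_funK t a)).
by exists (fun a _ => d a).
Qed.

Lemma shifted_section (E : extension M) (s : section E) (d : cochain M (@X0 _ V A)) :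
  exists t : section E, forall a, diff (s a) (d a (X0cell a)) (t a).
Proof.
have H a := diff_exr (d a (X0cell a)) (sec_funK s a).
have [t tP] := choice H.
by exists (Section_ (fun a => diff_pir (tP a))).
Qed.

(** The equivalence sends s(a) + x to t(a) + x.  It respects operations because
    w(s(a) + x) = s(w(a)) + f[w; a] + w(x), and likewise for t, with the same
    f. *)
Lemma equivalent_of_factor_set (E F : extension M) (s : section E) (t : section F) :
  factor_set s = factor_set t -> equivalent E F.
Proof.
move=> st.
pose R (e : E) (e' : F) := exists a (x : M a), diff (s a) x e /\ diff (t a) x e'.
have Rpi e e' : R e e' -> ext_pi E e = ext_pi F e'.
  by move=> [a [x [/diff_pir -> /diff_pir ->]]].
have Rfun e e1 e2 : R e e1 -> R e e2 -> e1 = e2.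
  move=> [a [x [dx dx1]]] [a' [x' [dx' dx2]]].
  have ea : a = a' by rewrite -(diff_pir dx) (diff_pir dx').
  case: _ / ea x' dx' dx2 => x' dx' dx2.
  by apply: diff_funr dx1 _; rewrite (diff_inj dx dx').
have Rex e : exists e', R e e'.
  have [x dx] := diff_ex (sec_funK s (ext_pi E e)) (erefl (ext_pi E e)).
  have [e' dx'] := diff_exr x (sec_funK t (ext_pi E e)).
  by exists e', (ext_pi E e), x.
have Ropr (w : Omega) (e : 'I_(arity w) -> E) (e' : 'I_(arity w) -> F) :
    (forall i, R (e i) (e' i)) -> R (opr e) (opr e').
  move=> H; have {H} /dependent_choice[x xP] : forall i,
      exists x : M (ext_pi E (e i)), diff (s (ext_pi E (e i))) x (e i) /\
        diff (t (ext_pi E (e i))) x (e' i).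
    by move=> i; have [a [x [dx dx']]] := H i; rewrite (diff_pir dx); exists x.
  set b := fun i => ext_pi E (e i) in x xP.
  have p := clo_eval_opr b (valgP A).
  have d1 := diff_factor_set s p.
  have d2 := diff_factor_set t p.
  rewrite clo_eval_opr in d1; last exact: valgP.
  rewrite clo_eval_opr -?st in d2; last exact: valgP.
  exists (opr b), (factor_set s (X1cell p) + ab_opr x); split.
    by apply: diff_trans d1 _ => //; apply: diff_opr => i; case: (xP i).
  by apply: diff_trans d2 _ => //; apply: diff_opr => i; case: (xP i).
have [g gP] := choice Rex.
have gopr (w : Omega) (e : 'I_(arity w) -> E) : g (opr e) = opr (fun i => g (e i)).
  by apply: Rfun (gP _) _; apply: Ropr.
apply: (@equivalent_of_diff _ _ (Hom gopr)) => /= [e|e a x e' dx]; first exact: Rpi.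
have ea := diff_pi dx; have [b [y [dy dy']]] := gP e.
have ab : b = a by rewrite -(diff_pir dy) (diff_pi dx).
case: _ / ab x dx ea => x dx ea.
have [e1 dx'] := diff_exr x (diff_pir dy').
suff <- : e1 = g e' by [].
apply: Rfun _ (gP _); exists b, (y + x); split.
  exact: (diff_trans hV hmod dy dx).
exact: (diff_trans hV hmod dy' dx').
Qed.

End Modular.
End Extensions.

(** * The extension of a cocycle *)

Section ExtensionOfCocycle.
Variables (Omega : signature) (V : algebra Omega -> Prop) (hV : variety V).
Variables (A : valgebra V) (M : Ab V A) (f : cochain M (@X1 _ V A)).
Hypothesis bf : bd1 f = 0.

(** The cocycle identity with the values c of the inner terms free: terms and
    their classes have values that are equal only propositionally. *)
Lemma cocycleE n' n (v' : Clo V n') (v : 'I_n' -> Clo V n) (b : 'I_n -> A)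
    (c : 'I_n' -> A) (cb : forall i, clo_eval (v i) b = c i) (a : A)
    (e : clo_eval v' c = a) (e' : clo_eval (clo_comp v' v) b = a) :
  f (X1cell e') =
    ecast a (M a) e (clo_over v' (fun i => f (X1cell (cb i)))) + f (X1cell e).
Proof.
have ec : (fun i => clo_eval (v i) b) = c by apply/funext.
case: _ / ec cb e => cb e; case: _ / e e' => e' /=.
rewrite (_ : cb = fun=> erefl); last exact: Prop_irrelevance.
have := congr1 (fun g : cochain M (@X2 _ V A) => g _
  (X2cell (erefl (clo_eval v' (fun i => clo_eval (v i) b))))) bf.
rewrite /bd1 /= addrAC => /eqP; rewrite subr_eq add0r => /eqP ->.
by congr (f (X1cell _)); apply: Prop_irrelevance.
Qed.

Lemma clo_over_pi n (t : term Omega n) (b : 'I_n -> A) (x : forall i, M (b i))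
    (e : clo_eval (\pi_(Clo V n) t) b = eval t b) :
  ecast a (M a) e (clo_over (\pi_(Clo V n) t) x) =
  over_eval (Q := over_of_ab M) t x.
Proof.
apply: ecast_Tagged.
have := clo_piE t
  (fun i => Tagged (fun a => M a : Type) (x i) : total_algebra (over_of_ab M))
  (totally_in M).
by rewrite /clo_eval !(eval_total_algebra (Q := over_of_ab M)).
Qed.

(** Pairs (a, m) stand for s(a) + m, s being the section whose factor set is to
    become f; this dictates the operations. *)
Definition twisted_opr (w : Omega) (p : 'I_(arity w) -> {a : A & M a}) :
    {a : A & M a} :=
  Tagged (fun a => M a) (ab_opr (fun i => tagged (p i)) +
    f (X1cell (clo_eval_opr (fun i => tag (p i)) (valgP A)))).

Definition twisted_algebra : algebra Omega := Algebra twisted_opr.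

(** Take v' = x_i and v the tuple of variables in the cocycle identity: the
    composite is x_i again, so f[x_i; b] = f[x_i; b] + f[x_i; b]. *)
Lemma cocycle_Var n (i : 'I_n) (b : 'I_n -> A)
    (e : clo_eval (\pi_(Clo V n) (Var Omega i)) b = b i) :
  f (X1cell e) = 0.
Proof.
have cb j : clo_eval (\pi_(Clo V n) (Var Omega j)) b = b j.
  by rewrite clo_piE //; exact: valgP.
have e' : clo_eval (clo_comp (\pi_(Clo V n) (Var Omega i))
    (fun j => \pi_(Clo V n) (Var Omega j))) b = b i.
  by rewrite clo_compE ?clo_piE //; exact: valgP.
have := cocycleE cb e e'; rewrite clo_over_pi /=.
rewrite (@X1cell_clo _ _ _ _ f _ _ _ _ _ e' (cb i)).
  by move=> /eqP; rewrite -{1}[f (X1cell (cb i))]addr0 (inj_eq (addrI _)) => /eqP.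
by apply: clo_ext => B VB c; rewrite clo_compE // clo_piE.
Qed.

(** In the inductive step the sum of w(f[ts; b]) and f[w; ts(b)] is f[w(ts); b]
    by the cocycle identity for v' = w. *)
Lemma eval_twisted n (t : term Omega n) (b : 'I_n -> A) (x : forall i, M (b i)) :
  eval t (fun i => Tagged (fun a => M a) (x i) : twisted_algebra) =
  Tagged (fun a => M a) ((over_eval (Q := over_of_ab M) t x : M (eval t b)) +
    f (X1cell (clo_piE t b (valgP A)))).
Proof.
elim: t => [i|w ts IH]; first by rewrite cocycle_Var addr0.
transitivity (opr (a := twisted_algebra) (fun j => Tagged (fun a => M a)
  ((over_eval (Q := over_of_ab M) (ts j) x : M (eval (ts j) b)) +
    f (X1cell (clo_piE (ts j) b (valgP A)))) : twisted_algebra)).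
  by rewrite /=; congr twisted_opr; apply/funext.
congr (Tagged _ _) => /=; rewrite ab_oprD -addrA; congr (_ + _).
have e' : clo_eval (clo_comp (\pi_(Clo V _) (App (fun i => Var Omega i)))
    (fun j => \pi_(Clo V n) (ts j))) b = opr (fun j => eval (ts j) b).
  rewrite clo_compE ?clo_eval_opr; try exact: valgP.
  by congr opr; apply/funext => j; rewrite clo_piE //; exact: valgP.
rewrite (@X1cell_clo _ _ _ _ f _ _ _ _ _ _ e').
  rewrite (cocycleE (fun j => clo_piE (ts j) b (valgP A))
    (clo_eval_opr (fun j => eval (ts j) b) (valgP A)) e').
  by rewrite (clo_over_pi (t := App (fun i => Var Omega i))).
apply: clo_ext => B VB c; rewrite clo_compE // clo_eval_opr // clo_piE //=.
by congr opr; apply/funext => j; rewrite clo_piE.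
Qed.

(** If s = t is an identity of V, then s and t agree in the total algebra of M
    and have the same class in the clone, so both summands in [eval_twisted]
    agree. *)
Lemma twisted_algebraP : V twisted_algebra.
Proof.
have [Sigma SigmaP] := hV; apply/SigmaP => n s t st p.
have Vst B : V B -> holds B s t by move=> /SigmaP; apply.
have -> : p = fun i => Tagged (fun a => M a) (tagged (p i)).
  by apply/funext => i; case: (p i).
rewrite !eval_twisted.
have := Vst _ (totally_in M) (fun i => Tagged (fun a => M a : Type) (tagged (p i))).
rewrite !(eval_total_algebra (Q := over_of_ab M)).
set b := fun i => tag (p i).
have st_pi : \pi_(Clo V n) s = \pi_(Clo V n) t by apply/eqmodP/asboolP.
move: (clo_piE s b _) (clo_piE t b _).
move: (over_eval s _) (over_eval t _); rewrite /=.
move: (eval s b) (eval t b) => a1 a2 x y p1 p2 xy.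
have ea := projT1_eq xy; rewrite /= in ea; case: _ / ea y p2 xy => y p2 xy.
have -> : x = y by exact: (@ecast_Tagged _ _ _ M _ _ x y erefl xy).
by rewrite (X1cell_clo f p1 p2).
Qed.

Definition twisted_valgebra : valgebra V := VAlgebra twisted_algebraP.

Definition twisted_pi : hom twisted_valgebra A :=
  @Hom Omega twisted_valgebra A (fun e => tag e) (fun w b => erefl).

Lemma twisted_pi_onto a : exists e, twisted_pi e = a.
Proof. by exists (Tagged (fun a => M a) (0 : M a)). Qed.

Definition twisted_add (e : twisted_valgebra) (m : M (twisted_pi e)) :
    star (kernel twisted_pi) e :=
  exist (kernel twisted_pi e) (Tagged (fun a => M a) (tagged e + m)) erefl.

Definition twisted_sub (e : twisted_valgebra) (c : star (kernel twisted_pi) e) :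
    M (twisted_pi e) :=
  ecast a (M a) (esym (proj2_sig c)) (tagged (sval c)) - tagged e.

Lemma twisted_addK e : cancel (@twisted_add e) (@twisted_sub e).
Proof. by move=> m; rewrite /twisted_sub /= addrC addKr. Qed.

Lemma twisted_subK e : cancel (@twisted_sub e) (@twisted_add e).
Proof.
case: e => b x [[a y] p]; simpl in p; case: _ / p y => y; rewrite /twisted_sub /=.
apply: eq_sig_hprop => [*|/=]; first exact: Prop_irrelevance.
by rewrite addrC subrK.
Qed.

Lemma twisted_add_hom :
  @is_pointed_hom _ _ (Res twisted_pi M) (star (kernel twisted_pi)) twisted_add.
Proof.
split=> [w e m|e]; (apply: eq_sig_hprop => [*|/=]; first exact: Prop_irrelevance).
  by rewrite /twisted_opr /= ab_oprD addrAC.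
by rewrite addr0; case: e.
Qed.

Lemma twisted_sub_hom :
  @is_pointed_hom _ _ (star (kernel twisted_pi)) (Res twisted_pi M) twisted_sub.
Proof.
split=> [w e c|e]; apply: (can_inj (@twisted_addK _)); rewrite twisted_subK.
  rewrite (pointed_hom_opr twisted_add_hom); congr over_opr.
  by apply: functional_extensionality_dep => i; rewrite twisted_subK.
by rewrite (pointed_hom_base twisted_add_hom).
Qed.

Definition twisted_extension : extension M :=
  Extension twisted_pi_onto
    (PointedIso twisted_add_hom twisted_sub_hom twisted_addK twisted_subK).

Definition zero_section : section twisted_extension :=
  @Section_ _ _ _ _ twisted_extension
    (fun a => Tagged (fun a => M a) (0 : M a)) (fun a => erefl).

(** By [eval_twisted], v applied to the pairs (b, 0) is (v(b), 0 + f[v; b]). *)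
Lemma factor_set_zero_section : factor_set zero_section = f.
Proof.
apply/esym/factor_setP => n v b /=; exists erefl => /=; rewrite add0r.
rewrite /clo_eval (eval_twisted (repr v) (fun i => 0 : M (b i))).
have -> : over_eval (Q := over_of_ab M) (repr v) (fun i => 0 : M (b i)) = 0 :> M _.
  by elim: (repr v) => //= w ts IH; rewrite (_ : (fun _ => _) = fun j => 0) ?ab_opr0 //;
    apply: functional_extensionality_dep.
rewrite add0r; congr Tagged; apply: X1cell_clo; exact/esym/reprK.
Qed.

End ExtensionOfCocycle.

(** * Cohomology classes and the bijection *)

Section Classes.
Variables (Omega : signature) (V : algebra Omega -> Prop) (A : valgebra V).
Variable M : Ab V A.

Lemma cohomology_classP (z z' : cocycle M) :
  cohomology_class z = cohomology_class z' <->
  exists d, cocycle_val z = cocycle_val z' + bd0 d.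
Proof.
split.
  move=> /eqP; rewrite -Quotient.idealrBE => /asboolP[d dE]; exists d.
  by rewrite -dE addrC subrK.
move=> [d dE]; apply/eqP; rewrite -Quotient.idealrBE; apply/asboolP; exists d.
by rewrite /= dE addrC addKr.
Qed.

End Classes.

Theorem theorem6p1 (Omega : signature) (V : algebra Omega -> Prop)
    (hV : variety V) (hmod : congruence_modular V)
    (A : valgebra V) (M : Ab V A) :
  exists Phi : ext_classes M -> cohomology M,
    bijective Phi /\
    forall (E : extension M) (s : section E),
      exists z : cocycle M,
        cocycle_val z = factor_set s /\
        Phi (ext_class E) = cohomology_class z.
Proof.
have fsP (E : extension M) (s : section E) : factor_set s \in [pred f | bd1 f == 0].
  by rewrite inE factor_set_cocycle.
pose fs E (s : section E) := Cocycle (fsP E s).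
have classP E F (s : section E) (t : section F) :
    cohomology_class (fs _ s) = cohomology_class (fs _ t) <-> ext_class E = ext_class F.
  split=> [/cohomology_classP[d /= sd]|/ext_classP[f]].
    have [t' tt'] := shifted_section t d.
    apply/ext_classP/(@equivalent_of_factor_set _ _ _ _ hV hmod _ _ s t').
    by rewrite (factor_set_shift hV hmod tt').
  have [t' fE] := factor_set_equivalence f s.
  have [d dE] := sections_shift t t'.
  apply/cohomology_classP; exists d => /=.
  by rewrite -fE; apply: factor_set_shift.
(* Phi is chosen class by class; its value is forced by any section. *)
have Phi_ex (C : ext_classes M) : exists h, forall E (s : section E),
    C = ext_class E -> h = cohomology_class (fs _ s).
  have [E ->] := ext_class_surj C; have [s] := section_exists E.
  by exists (cohomology_class (fs _ s)) => F t EF; apply/classP.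
pose Phi C := projT1 (cid (Phi_ex C)).
have PhiE E (s : section E) : Phi (ext_class E) = cohomology_class (fs _ s).
  by rewrite /Phi; case: cid => h /=; apply.
have zP (z : cocycle M) : bd1 (cocycle_val z) = 0.
  by apply/eqP; have := cocycle_valP z; rewrite inE.
exists Phi; split; last by move=> E s; exists (fs _ s); rewrite (PhiE _ s).
have fs_ext (z : cocycle M) : fs _ (zero_section hV (zP z)) = z.
  by apply: val_inj; apply: factor_set_zero_section.
(* The inverse twists by the chosen representative of a cohomology class. *)
pose Psi (h : cohomology M) := ext_class (twisted_extension hV (zP (repr h))).
have PsiK : cancel Psi Phi.
  move=> h; rewrite /Psi (PhiE _ (zero_section hV (zP (repr h)))) fs_ext.
  exact: reprK.
exists Psi => // C; have [E ->] := ext_class_surj C; have [s] := section_exists E.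
rewrite (PhiE _ s).
have := PsiK (cohomology_class (fs _ s)).
by rewrite {2}/Psi (PhiE _ (zero_section hV (zP _))) => /classP.
Qed.
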